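(* Let $\mathfrak{A}=\{\mathfrak{a}_1,\dots,\mathfrak{a}_n\}$ and $\mathfrak{B}=\{\mathfrak{b}_1,\dots,\mathfrak{b}_n\}$ be sets of applied ML systems such that each $\mathfrak{a}_i$ is Equally Trustworthy with respect to $\mathfrak{b}_i$ regarding a set of values $B^i$. If $\mathfrak{a}_1,\dots,\mathfrak{a}_n\mapsto^{cstr}\mathfrak{c}$ and $\mathfrak{b}_1,\dots,\mathfrak{b}_n\mapsto^{cstr}\mathfrak{d}$, and the target variable of $\mathfrak{d}$ is identical to that of $\mathfrak{c}$, then for every value $\delta$ in the closure of $\bigcup_{i=1}^n B^i$ under $\to$, $+^{\perp}$, $\times$ and $\bot$, if $\mathfrak{c}:\delta_f$ then $\mathfrak{d}:\delta_f$. Hence $\mathfrak{c}$ is Equally Trustworthy with respect to $\mathfrak{d}$ regarding all values in that closure.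
   Context: TNDPQ. Atomic variables each have finitely many atomic values, exhaustive and pairwise mutually exclusive. Variables: atomic variables closed under pairing $\langle t,u\rangle$ and conditional $[t]u$. Values: atomic values closed under negation $\beta^{\bot}$, disjunction $+$, product $\times$, implication $\to$. An applied ML system $\mathfrak{a}$ is a Training Set $\Gamma$, Learning Algorithm $A$, list of value attributions $\sigma$ and target variable $t$; $\mathfrak{a}:\beta_f$ (also $\sigma\rhd t:\beta_f$) means the system gives probability $f$ to $t$ receiving value $\beta$ for individuals described by $\sigma$. Mutual exclusivity $\beta\perp\delta$ (for a variable $t$) means $\beta\times\delta\to\bot$ is provable in classical propositional logic (reading $\times,+,\bot,\to$ as $\wedge,\vee,\neg,\to$) plus, for each atomic variable in $t$, axioms stating its atomic values are pairwise exclusive and exhaustive. The closure under $+^{\perp}$ adds $\beta+\delta$ only when $\beta\perp\delta$. Right I-rules (same $\Gamma,A$ in premises and conclusion): I$\to$: from $\sigma,t:\beta\rhd u:\delta_g$ infer $\sigma\rhd[t]u:(\beta\to\delta)_g$; I$\times$1: from $\sigma,t:\beta\rhd u:\delta_g$ and $\sigma\rhd t:\beta_f$ infer $\sigma\rhd\langle t,u\rangle:(\beta\times\delta)_{fg}$; I$\times$2: from $\sigma,u:\delta\rhd t:\beta_g$ and $\sigma\rhd u:\delta_f$ infer $\sigma\rhd\langle t,u\rangle:(\beta\times\delta)_{fg}$; I$\rhd+$: from $\sigma\rhd u:\delta_f$, $\sigma\rhd u:\gamma_g$ and $\delta\perp\gamma$ infer $\sigma\rhd u:(\delta+\gamma)_{f+g}$;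 I$\rhd\bot$: from $\sigma\rhd u:\delta_g$ infer $\sigma\rhd u:\delta^\bot_{1-g}$. $\mathfrak{a}_1,\dots,\mathfrak{a}_n\mapsto^{cstr}\mathfrak{b}$ iff for some values $\beta^i,\delta$ and probabilities $f_i,h$, $\mathfrak{b}:\delta_h$ is derivable from $\mathfrak{a}_1:\beta^1_{f_1},\dots,\mathfrak{a}_n:\beta^n_{f_n}$ using only right I-rules. For applied systems $\mathfrak{a}$ (copy) and $\mathfrak{b}$ (original) with the same target variable $t$ and same $\sigma$, differing in Learning Algorithm or Training Set: $\mathfrak{a}$ is Equally Trustworthy w.r.t. $\mathfrak{b}$ regarding a set of values $B$ iff for every $\beta\in B$, $\mathfrak{a}:\beta_f$ iff $\mathfrak{b}:\beta_f$.
   Formalization: For c and d, the judgements c:δ_f and d:δ_f are read as derivable by right I-rules from true judgements of the a_i (resp. b_i) on values in B^i only, and in the construction relation every a_i (b_i) must occur as a premise; with other or idle premises the claim fails. *)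

(* Defs.v *)
From Stdlib Require Import Reals List Arith.
Import ListNotations.
Set Implicit Arguments.
Open Scope R_scope.

(** * Variables and values *)

(** Different atomic variables may share atomic values (e.g. yes/no). *)
Record signature := Signature {
  avar : Type;
  aval : Type;
  avals_of : avar -> list aval;
  avals_of_nonempty : forall x, avals_of x <> []
}.

(** [VPair t u] is <t,u>;  [VCond t u] is [t]u. *)
Inductive var (S : signature) : Type :=
| VAtom (x : avar S)
| VPair (t u : var S)
| VCond (t u : var S).

Inductive value (S : signature) : Type :=
| Val (v : aval S)
| Neg (b : value S)
| Add (b c : value S)
| Mul (b c : value S)
| Imp (b c : value S).

(** * Mutual exclusivity: provability in classical propositional logic *)

Inductive form (A : Type) : Type :=
| FAtom (v : A)
| FBot
| FAnd (p q : form A)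
| FOr (p q : form A)
| FImp (p q : form A).
Arguments FBot {A}.

Definition FNot A (p : form A) : form A := FImp p FBot.

(** Natural deduction for classical logic with additional axioms [Ax]. *)
Inductive provable A (Ax : form A -> Prop) : list (form A) -> form A -> Prop :=
| P_ax G p : Ax p -> provable Ax G p
| P_hyp G p : In p G -> provable Ax G p
| P_andI G p q : provable Ax G p -> provable Ax G q -> provable Ax G (FAnd p q)
| P_andE1 G p q : provable Ax G (FAnd p q) -> provable Ax G p
| P_andE2 G p q : provable Ax G (FAnd p q) -> provable Ax G q
| P_orI1 G p q : provable Ax G p -> provable Ax G (FOr p q)
| P_orI2 G p q : provable Ax G q -> provable Ax G (FOr p q)
| P_orE G p q r : provable Ax G (FOr p q) ->
    provable Ax (p :: G) r -> provable Ax (q :: G) r -> provable Ax G r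
| P_impI G p q : provable Ax (p :: G) q -> provable Ax G (FImp p q)
| P_impE G p q : provable Ax G (FImp p q) -> provable Ax G p -> provable Ax G q
| P_raa G p : provable Ax (FNot p :: G) FBot -> provable Ax G p.

Fixpoint form_of S (b : value S) : form (aval S) :=
  match b with
  | Val _ v => FAtom v
  | Neg b => FNot (form_of b)
  | Add b c => FOr (form_of b) (form_of c)
  | Mul b c => FAnd (form_of b) (form_of c)
  | Imp b c => FImp (form_of b) (form_of c)
  end.

Fixpoint occurs S (x : avar S) (t : var S) : Prop :=
  match t with
  | VAtom _ y => x = y
  | VPair t u | VCond t u => occurs x t \/ occurs x u
  end.

Fixpoint big_or A (l : list A) : form A :=
  match l with
  | [] => FBot
  | [v] => FAtom v
  | v :: l' => FOr (FAtom v) (big_or l')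
  end.

Inductive atom_axiom S (t : var S) : form (aval S) -> Prop :=
| Ax_excl x v w : occurs x t -> In v (avals_of S x) -> In w (avals_of S x) ->
    v <> w -> atom_axiom t (FNot (FAnd (FAtom v) (FAtom w)))
| Ax_exh x : occurs x t -> atom_axiom t (big_or (avals_of S x)).

Definition exclusive S (t : var S) (b d : value S) : Prop :=
  provable (atom_axiom t) [] (FImp (FAnd (form_of b) (form_of d)) FBot).

(** Closure under ->, +^perp, x and negation.  Exclusivity is relative to a
    variable; a sum is added as soon as its summands are exclusive for some
    variable. *)
Inductive closure S (U : value S -> Prop) : value S -> Prop :=
| C_base b : U b -> closure U b
| C_imp b d : closure U b -> closure U d -> closure U (Imp b d)
| C_add t b d : closure U b -> closure U d -> exclusive t b d ->
    closure U (Add b d)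
| C_mul b d : closure U b -> closure U d -> closure U (Mul b d)
| C_neg b : closure U b -> closure U (Neg b).

(** * Applied systems, judgements and the right I-rules *)

(** [TS] and [LA] are the types of training sets and of learning algorithms. *)
Record system (S : signature) (TS LA : Type) := System {
  training : TS;
  algorithm : LA;
  attributions : list (var S * value S);
  target : var S
}.
Arguments System {S TS LA}.

(** [Judgement a b f] is the judgement a : b_f. *)
Record judgement (S : signature) (TS LA : Type) := Judgement {
  j_system : system S TS LA;
  j_value : value S;
  j_prob : R
}.
Arguments Judgement {S TS LA}.

(** [derivation l j]: there is a derivation tree of [j] that uses only right
    I-rules and whose leaves are exactly the members of [l].  Attributions are
    lists and "s, t:b" is [s ++ [(t, b)]].  The labels are probabilities: this is
    required of the leaves and of sums, and preserved by the other rules. *)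
Inductive derivation S TS LA :
  list (judgement S TS LA) -> judgement S TS LA -> Prop :=
| D_leaf a b f :
    0 <= f <= 1 ->
    derivation [Judgement a b f] (Judgement a b f)
| D_imp G A s t u b d g l :
    derivation l (Judgement (System G A (s ++ [(t, b)]) u) d g) ->
    derivation l (Judgement (System G A s (VCond t u)) (Imp b d) g)
| D_mul1 G A s t u b d f g l1 l2 :
    derivation l1 (Judgement (System G A (s ++ [(t, b)]) u) d g) ->
    derivation l2 (Judgement (System G A s t) b f) ->
    derivation (l1 ++ l2)
      (Judgement (System G A s (VPair t u)) (Mul b d) (f * g))
| D_mul2 G A s t u b d f g l1 l2 :
    derivation l1 (Judgement (System G A (s ++ [(u, d)]) t) b g) ->
    derivation l2 (Judgement (System G A s u) d f) ->
    derivation (l1 ++ l2)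
      (Judgement (System G A s (VPair t u)) (Mul b d) (f * g))
| D_add G A s u d c f g l1 l2 :
    derivation l1 (Judgement (System G A s u) d f) ->
    derivation l2 (Judgement (System G A s u) c g) ->
    exclusive u d c -> f + g <= 1 ->
    derivation (l1 ++ l2) (Judgement (System G A s u) (Add d c) (f + g))
| D_neg G A s u d g l :
    derivation l (Judgement (System G A s u) d g) ->
    derivation l (Judgement (System G A s u) (Neg d) (1 - g)).

(** a_0, ..., a_(n-1) |->^cstr c.  Every a_i takes part in the derivation: if
    some could be left idle, two unrelated members of the family with a common
    target would both be "constructed" from the whole family. *)
Definition constructs S TS LA (n : nat) (a : nat -> system S TS LA)
    (c : system S TS LA) : Prop :=
  exists (b : nat -> value S) (f : nat -> R) (d : value S) (h : R)
         (l : list (judgement S TS LA)),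
    (forall j, In j l <->
       exists i, (i < n)%nat /\ j = Judgement (a i) (b i) (f i)) /\
    derivation l (Judgement c d h).

(** [gives a b f] is the given behaviour of the component systems: a : b_f.
    For a system c built out of a_0, ..., a_(n-1), c : d_f means that the
    judgement follows by right I-rules from what the components give on the
    values under consideration, a_i being consulted on B_i only: a judgement
    about c that rests on other systems or on other values of a_i is not
    constrained by the behaviour of the a_i on B_i. *)
Definition composed S TS LA (gives : system S TS LA -> value S -> R -> Prop)
    (n : nat) (a : nat -> system S TS LA) (B : nat -> value S -> Prop)
    (c : system S TS LA) (d : value S) (f : R) : Prop :=
  exists l : list (judgement S TS LA),
    (forall j, In j l -> exists i b g,
       (i < n)%nat /\ B i b /\ gives (a i) b g /\ j = Judgement (a i) b g) /\
    derivation l (Judgement c d f).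

(** The copy [a] is Equally Trustworthy w.r.t. the original [b] regarding [B],
    where [Ja] and [Jb] say which judgements hold of [a] and of [b]. *)
Definition equally_trustworthy S TS LA
    (Ja Jb : system S TS LA -> value S -> R -> Prop)
    (a b : system S TS LA) (B : value S -> Prop) : Prop :=
  target a = target b /\
  attributions a = attributions b /\
  (algorithm a <> algorithm b \/ training a <> training b) /\
  (forall v f, B v -> (Ja a v f <-> Jb b v f)).

(* Main.v *)
(** Right I-rules never change the training set or the learning algorithm, so a
    derivation about [c] becomes one about [d] by relabelling the leaves.  What
    has to be proved is that [c] and [d] have the same attributions, i.e. that
    the attributions and targets of the leaves, together with the target of the
    root, determine the attributions of the root.

    Let the root target be [t1]...[tk]X, where X is not a conditional.  A leaf
    whose target is at least as large as X has consumed some of the ti, and their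
    number gives the length of the root attributions.  If every leaf target is
    smaller than X, then X = <x,y>, and at the position k places after the root
    attributions one premise of an Ix rule records x (say), while the other one
    records only variables smaller than x, or nothing.  With longer root
    attributions this position would hold the same variable in all leaves. *)

Require Import Defs.
From Stdlib Require Import Reals List Arith Lia.
Import ListNotations.

(** * Splitting a target [[t1]...[tk]X] into its conditions and its body *)

Fixpoint vsize {S} (t : var S) : nat :=
  match t with
  | VAtom _ _ => 1
  | VPair t u | VCond t u => Datatypes.S (vsize t + vsize u)
  end.

Fixpoint conds {S} (t : var S) : list (var S) :=
  match t with
  | VCond t u => t :: conds u
  | _ => []
  end.

Fixpoint body {S} (t : var S) : var S :=
  match t with
  | VCond _ u => body u
  | t => t
  end.

Lemma vsize_body {S} (t : var S) : (vsize (body t) <= vsize t)%nat.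
Proof. induction t; simpl; lia. Qed.

Lemma derivation_nonempty {S TS LA} {l : list (judgement S TS LA)} {j} :
  derivation l j -> exists i, In i l.
Proof.
  induction 1; [eauto using in_eq | ..];
    match goal with IH : exists i, In i _ |- _ => destruct IH end;
    eauto using in_or_app.
Qed.

Lemma derivation_training_algorithm {S TS LA} {l : list (judgement S TS LA)} {j} :
  derivation l j -> forall i, In i l ->
  training (j_system i) = training (j_system j) /\
  algorithm (j_system i) = algorithm (j_system j).
Proof.
  induction 1; intros i Hi; simpl in *; try apply in_app_or in Hi as [];
    auto.
  destruct Hi as [<- | []]; auto.
Qed.

(** [T] is the root target, [v] a leaf target, [e] what the leaf attributions add to those of the
    root. A leaf at least as large as [body T] has met no product rule, so [e] only counts
    discharged conditions; a smaller one has all of [conds T] at the front of [e]. *)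
Definition leaf_shape {S} (T v : var S) (e : list (var S * value S)) : Prop :=
  (vsize v <= vsize T)%nat /\
  Forall (fun p => (vsize (fst p) < vsize T)%nat) e /\
  ((vsize (body T) <= vsize v /\
    length e + length (conds v) = length (conds T))%nat \/
   (vsize v < vsize (body T))%nat /\ exists r, map fst e = conds T ++ r).

Lemma leaf_shape_cond {S} (t u v : var S) b e :
  leaf_shape u v e -> leaf_shape (VCond t u) v ((t, b) :: e).
Proof.
  intros (Hv & He & H); repeat split; simpl.
  - lia.
  - constructor; [simpl; lia|].
    eapply Forall_impl, He; simpl; intros; lia.
  - destruct H as [[H1 H2] | [H1 [r Hr]]]; [left; lia | right].
    split; [assumption|]. exists r; simpl; now rewrite Hr.
Qed.

(** Leaves over a premise of a product rule are smaller than the pair, and a pair has no conditions,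
    so the second case holds trivially. Here [w] is the target of the premise and [e'] what the rule
    adds to its attributions. *)
Lemma leaf_shape_pair {S} (t u w v : var S) e e' :
  (vsize w < vsize (VPair t u))%nat ->
  Forall (fun p => (vsize (fst p) < vsize (VPair t u))%nat) e' ->
  leaf_shape w v e -> leaf_shape (VPair t u) v (e' ++ e).
Proof.
  intros Hw He' (Hv & He & _); repeat split.
  - lia.
  - apply Forall_app; split; [assumption|].
    eapply Forall_impl, He; simpl in *; intros; lia.
  - right; split; [simpl in *; lia|]. now eexists.
Qed.

Lemma derivation_leaf_shape {S TS LA} {l : list (judgement S TS LA)} {j} :
  derivation l j -> forall i, In i l ->
  exists e,
    attributions (j_system i) = attributions (j_system j) ++ e /\
    leaf_shape (target (j_system j)) (target (j_system i)) e.
Proof.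
  induction 1 as
    [[G A s t] b f Hf
    | G A s t u b d g l _ IH
    | G A s t u b d f g l1 l2 _ IH1 _ IH2
    | G A s t u b d f g l1 l2 _ IH1 _ IH2
    | G A s u d c f g l1 l2 _ IH1 _ IH2 _ _
    | G A s u d g l _ IH]; intros i Hi; simpl in *.
  - destruct Hi as [<- | []]; simpl.
    exists []; split; [now rewrite app_nil_r|].
    repeat split; auto. left; split; [apply vsize_body | reflexivity].
  - destruct (IH i Hi) as (e & He & Hs).
    exists ((t, b) :: e); split; [now rewrite He, <- app_assoc|].
    now apply leaf_shape_cond.
  - apply in_app_or in Hi as [Hi | Hi].
    + destruct (IH1 i Hi) as (e & He & Hs).
      exists ([(t, b)] ++ e); split; [now rewrite He, <- app_assoc|].
      apply leaf_shape_pair with (w := u); auto; simpl; [lia|].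
      constructor; [simpl; lia | constructor].
    + destruct (IH2 i Hi) as (e & He & Hs).
      exists e; split; [assumption|].
      apply leaf_shape_pair with (w := t) (e' := []); auto; simpl; lia.
  - apply in_app_or in Hi as [Hi | Hi].
    + destruct (IH1 i Hi) as (e & He & Hs).
      exists ([(u, d)] ++ e); split; [now rewrite He, <- app_assoc|].
      apply leaf_shape_pair with (w := t); auto; simpl; [lia|].
      constructor; [simpl; lia | constructor].
    + destruct (IH2 i Hi) as (e & He & Hs).
      exists e; split; [assumption|].
      apply leaf_shape_pair with (w := u) (e' := []); auto; simpl; lia.
  - apply in_app_or in Hi as []; auto.
  - auto.
Qed.

(** * Leaves that disagree at a fixed position *)

Definition attributed_var {S TS LA} (j : judgement S TS LA) (k : nat) :
    option (var S) :=
  nth_error (map fst (attributions (j_system j))) k.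

Lemma product_premises_differ {S TS LA} {l1 l2 : list (judgement S TS LA)}
    {G A s t u b d b' f g} :
  derivation l1 (Judgement (System G A (s ++ [(t, b)]) u) d g) ->
  derivation l2 (Judgement (System G A s t) b' f) ->
  exists i1 i2, In i1 l1 /\ In i2 l2 /\
    attributed_var i1 (length s) <> attributed_var i2 (length s).
Proof.
  intros H1 H2.
  destruct (derivation_nonempty H1) as [i1 Hi1].
  destruct (derivation_nonempty H2) as [i2 Hi2].
  exists i1, i2; split; [assumption|]; split; [assumption|].
  destruct (derivation_leaf_shape H1 _ Hi1) as (e1 & He1 & _).
  destruct (derivation_leaf_shape H2 _ Hi2)
    as (e2 & He2 & _ & Hlt & _).
  unfold attributed_var; simpl in *.
  rewrite He1, He2, !map_app, <- app_assoc.
  assert (Hnth : forall r, nth_error (map fst s ++ r) (length s) = nth_error r 0)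
    by (intros r; rewrite nth_error_app2, length_map, Nat.sub_diag; auto;
        now rewrite length_map).
  rewrite !Hnth; simpl.
  (* Either [i2] has nothing at this position, or its entry is strictly smaller than [t], which [i1]
     has there. *)
  destruct e2 as [|[w c] e2]; simpl; [discriminate|].
  intros [= ->]. apply Forall_inv in Hlt; simpl in Hlt; lia.
Qed.

(** The position [k] is invariant under the implication rule, which trades one attribution for one
    condition. Leaves start the first alternative, products the second. *)
Lemma derivation_distinguished_leaf {S TS LA} {l : list (judgement S TS LA)} {j} :
  derivation l j ->
  (exists i, In i l /\
     (vsize (body (target (j_system j))) <= vsize (target (j_system i)))%nat) \/
  (exists i1 i2, In i1 l /\ In i2 l /\
     let k := (length (attributions (j_system j)) +
               length (conds (target (j_system j))))%nat in
     attributed_var i1 k <> attributed_var i2 k).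
Proof.
  induction 1 as
    [[G A s t] b f Hf
    | G A s t u b d g l _ IH
    | G A s t u b d f g l1 l2 H1 _ H2 _
    | G A s t u b d f g l1 l2 H1 _ H2 _
    | G A s u d c f g l1 l2 _ IH1 _ _ _ _
    | G A s u d g l _ IH]; simpl in *.
  - left; eexists; split; [now left | apply vsize_body].
  - rewrite length_app in IH; simpl in IH.
    now rewrite <- Nat.add_assoc in IH.
  - right. rewrite Nat.add_0_r.
    destruct (product_premises_differ H1 H2)
      as (i1 & i2 & ? & ? & ?).
    exists i1, i2; auto using in_or_app.
  - right. rewrite Nat.add_0_r.
    destruct (product_premises_differ H1 H2)
      as (i1 & i2 & ? & ? & ?).
    exists i1, i2; auto using in_or_app.
  - destruct IH1 as [(i & ? & ?) | (i1 & i2 & ? & ? & ?)]; [left | right].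
    + exists i; auto using in_or_app.
    + exists i1, i2; auto using in_or_app.
  - exact IH.
Qed.

(** * Leaf profiles and the root target determine the root attributions *)

Definition same_profile {S TS LA} (i j : judgement S TS LA) : Prop :=
  attributions (j_system i) = attributions (j_system j) /\
  target (j_system i) = target (j_system j).

Lemma root_attributions_length {S TS LA} {l l' : list (judgement S TS LA)} {j j'} :
  derivation l j -> derivation l' j' ->
  target (j_system j) = target (j_system j') ->
  (forall i, In i l -> exists i', In i' l' /\ same_profile i i') ->
  (length (attributions (j_system j')) <=
   length (attributions (j_system j)))%nat.
Proof.
  intros H H' Ht Hl.
  destruct (Nat.le_gt_cases (length (attributions (j_system j')))
              (length (attributions (j_system j)))) as [? | Hlt]; [assumption|].
  exfalso.
  (* A large leaf forces [e] and [e'] to have the same length, hence equally long root attributions,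
     against [Hlt]. *)
  assert (Hbig : forall i, In i l ->
    ~ (vsize (body (target (j_system j))) <= vsize (target (j_system i)))%nat).
  { intros i Hi Hs.
    destruct (Hl i Hi) as (i' & Hi' & Ha & Hti).
    destruct (derivation_leaf_shape H _ Hi) as (e & He & _ & _ & K).
    destruct (derivation_leaf_shape H' _ Hi')
      as (e' & He' & _ & _ & K').
    rewrite <- Hti, <- Ht in K'.
    apply (f_equal (@length _)) in He; apply (f_equal (@length _)) in He'.
    rewrite length_app in He, He'. rewrite Ha in He.
    destruct K as [[_ K] | [K _]]; [|lia].
    destruct K' as [[_ K'] | [K' _]]; lia. }
  destruct (derivation_distinguished_leaf H)
    as [(i & Hi & Hs) | (i1 & i2 & Hi1 & Hi2 & Hne)]; [now apply (Hbig i)|].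
  (* All leaves begin with [pre], and [Hlt] puts the distinguishing position inside it. *)
  set (pre := map fst (attributions (j_system j')) ++
              conds (target (j_system j'))).
  assert (Hpre : forall i k, In i l -> (k < length pre)%nat ->
            attributed_var i k = nth_error pre k).
  { intros i k Hi Hk.
    destruct (Hl i Hi) as (i' & Hi' & Ha & Hti).
    destruct (derivation_leaf_shape H' _ Hi')
      as (e' & He' & _ & _ & [[K' _] | [_ [r Hr]]]).
    - rewrite <- Ht, <- Hti in K'. now destruct (Hbig i Hi).
    - unfold attributed_var.
      rewrite Ha, He', map_app, Hr, app_assoc. now apply nth_error_app1. }
  apply Hne.
  assert (length pre = length (attributions (j_system j')) +
                       length (conds (target (j_system j))))%nat
    by (unfold pre; now rewrite length_app, length_map, Ht).
  rewrite !Hpre; auto; lia.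
Qed.

(** Both root attributions are prefixes of those of a common leaf profile, and the length bound in
    both directions makes them equally long. *)
Lemma root_attributions {S TS LA} {l l' : list (judgement S TS LA)} {j j'} :
  derivation l j -> derivation l' j' ->
  target (j_system j) = target (j_system j') ->
  (forall i, In i l -> exists i', In i' l' /\ same_profile i i') ->
  (forall i', In i' l' -> exists i, In i l /\ same_profile i' i) ->
  attributions (j_system j) = attributions (j_system j').
Proof.
  intros H H' Ht Hl Hl'.
  pose proof (root_attributions_length H H' Ht Hl) as L1.
  pose proof (root_attributions_length H' H (eq_sym Ht) Hl')
    as L2.
  destruct (derivation_nonempty H) as [i Hi].
  destruct (Hl i Hi) as (i' & Hi' & Ha & _).
  destruct (derivation_leaf_shape H _ Hi) as (e & He & _).
  destruct (derivation_leaf_shape H' _ Hi') as (e' & He' & _).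
  rewrite Ha, He' in He. apply (f_equal (firstn
    (length (attributions (j_system j))))) in He.
  rewrite !firstn_app, firstn_all, Nat.sub_diag in He.
  rewrite (Nat.le_antisymm _ _ L2 L1) in He.
  rewrite firstn_all, Nat.sub_diag in He; simpl in He.
  now rewrite !app_nil_r in He.
Qed.

(** * Relabelling and transfer between constructed systems *)

Definition retrain {S TS LA} (G : TS) (A : LA) (a : system S TS LA) :=
  System G A (attributions a) (target a).

Definition retrain_judgement {S TS LA} (G : TS) (A : LA)
    (j : judgement S TS LA) :=
  Judgement (retrain G A (j_system j)) (j_value j) (j_prob j).

Lemma derivation_retrain {S TS LA} (G : TS) (A : LA)
    {l : list (judgement S TS LA)} {j} :
  derivation l j ->
  derivation (map (retrain_judgement G A) l) (retrain_judgement G A j).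
Proof.
  induction 1; rewrite ?map_app; unfold retrain_judgement, retrain in *;
    simpl in *.
  - now constructor.
  - now apply D_imp.
  - now apply D_mul1.
  - now apply D_mul2.
  - now apply D_add.
  - now apply D_neg.
Qed.

Lemma retrain_eq {S TS LA} {a b : system S TS LA} {G : TS} {A : LA} :
  training b = G -> algorithm b = A ->
  attributions a = attributions b -> target a = target b ->
  retrain G A a = b.
Proof.
  unfold retrain; destruct b; simpl; intros -> -> -> ->; reflexivity.
Qed.

Lemma constructs_training_algorithm {S TS LA n} {a : nat -> system S TS LA} {c} :
  constructs n a c -> forall i, (i < n)%nat ->
  training (a i) = training c /\ algorithm (a i) = algorithm c.
Proof.
  intros (b & f & d & h & l & Hl & H) i Hi.
  apply (derivation_training_algorithm H
           (Judgement (a i) (b i) (f i))).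
  apply Hl; eauto.
Qed.

Lemma constructs_pos {S TS LA n} {a : nat -> system S TS LA} {c} :
  constructs n a c -> (0 < n)%nat.
Proof.
  intros (b & f & d & h & l & Hl & H).
  destruct (derivation_nonempty H) as [j Hj].
  apply Hl in Hj as (i & Hi & _); lia.
Qed.

(** The leaves of each derivation exhaust its family, so they match index by index, whatever values
    and probabilities they carry. *)
Lemma constructs_attributions {S TS LA n} {a b : nat -> system S TS LA} {c d} :
  constructs n a c -> constructs n b d -> target c = target d ->
  (forall i, (i < n)%nat ->
     attributions (a i) = attributions (b i) /\ target (a i) = target (b i)) ->
  attributions c = attributions d.
Proof.
  intros (va & fa & v & f & l & Hl & H) (vb & fb & v' & f' & l' & Hl' & H')
    Ht Hab.
  refine (root_attributions H H' Ht _ _); intros j Hj.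
  - apply Hl in Hj as (i & Hi & ->).
    exists (Judgement (b i) (vb i) (fb i)); split; [apply Hl'; eauto|].
    now apply Hab.
  - apply Hl' in Hj as (i & Hi & ->).
    exists (Judgement (a i) (va i) (fa i)); split; [apply Hl; eauto|].
    destruct (Hab i Hi); now split.
Qed.

(** Stated one way only, so that exchanging the two families gives the converse. *)
Lemma composed_transfer {S TS LA}
    {gives : system S TS LA -> value S -> R -> Prop}
    {n} {a b : nat -> system S TS LA} {B : nat -> value S -> Prop} {c d} :
  constructs n b d ->
  (forall i, (i < n)%nat ->
     attributions (a i) = attributions (b i) /\ target (a i) = target (b i)) ->
  (forall i v f, (i < n)%nat -> B i v -> gives (a i) v f -> gives (b i) v f) ->
  attributions c = attributions d -> target c = target d ->
  forall v f, composed gives n a B c v f -> composed gives n b B d v f.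
Proof.
  intros Hd Hab HB Hattr Ht v f (l & Hl & H).
  exists (map (retrain_judgement (training d) (algorithm d)) l); split.
  - intros j Hj. apply in_map_iff in Hj as (j0 & <- & Hj0).
    destruct (Hl j0 Hj0) as (i & w & g & Hi & Hw & Hg & ->).
    exists i, w, g; repeat split; auto.
    unfold retrain_judgement; simpl; f_equal.
    destruct (Hab i Hi).
    destruct (constructs_training_algorithm Hd i Hi).
    now apply retrain_eq.
  - apply (derivation_retrain (training d) (algorithm d)) in H.
    unfold retrain_judgement in H; simpl in H.
    now rewrite (retrain_eq (a := c) (b := d)) in H.
Qed.

Theorem mainTheorem10 (S : signature) (TS LA : Type)
    (gives : system S TS LA -> value S -> R -> Prop)
    (n : nat) (a b : nat -> system S TS LA) (B : nat -> value S -> Prop)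
    (hET : forall i, (i < n)%nat ->
       equally_trustworthy gives gives (a i) (b i) (B i))
    (c d : system S TS LA)
    (hc : constructs n a c) (hd : constructs n b d)
    (htarget : target d = target c) :
  (forall (v : value S) (f : R),
     closure (fun w => exists i, (i < n)%nat /\ B i w) v ->
     composed gives n a B c v f -> composed gives n b B d v f) /\
  equally_trustworthy (composed gives n a B) (composed gives n b B) c d
    (closure (fun w => exists i, (i < n)%nat /\ B i w)).
Proof.
  assert (Hab : forall i, (i < n)%nat ->
    attributions (a i) = attributions (b i) /\ target (a i) = target (b i))
    by (intros i Hi; now destruct (hET i Hi) as (? & ? & _)).
  assert (Hattr : attributions c = attributions d)
    by now apply (constructs_attributions hc hd).
  assert (Hcd : forall v f, composed gives n a B c v f ->
                            composed gives n b B d v f).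
  { apply composed_transfer; auto.
    intros i v f Hi Hv; now apply (hET i Hi). }
  assert (Hdc : forall v f, composed gives n b B d v f ->
                            composed gives n a B c v f).
  { apply composed_transfer; auto.
    - intros i Hi; destruct (Hab i Hi); now split.
    - intros i v f Hi Hv; now apply (hET i Hi). }
  split; [auto|].
  split; [auto|]; split; [auto|]; split; [|split; auto].
  (* [c] and [d] inherit training set and algorithm from [a 0] and [b 0], which differ in one of
     them; index 0 exists because every derivation has a leaf. *)
  pose proof (constructs_pos hc) as Hn.
  destruct (constructs_training_algorithm hc 0 Hn) as [<- <-].
  destruct (constructs_training_algorithm hd 0 Hn) as [<- <-].
  now destruct (hET 0%nat Hn) as (_ & _ & ? & _).
Qed.
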